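(* For all integers $n\ge 1$ and $\omega\ge 2n$, $$\sum_{j=0}^{\omega}\frac{\Gamma(\omega+\frac52)}{(\omega-j)!\,(j+n)!\,(2j+3)}\sum_{l=0}^{j+1}\frac{(-1)^l\,l^2\,(l^2-1)^{j+n}}{(j+l+1)!\,(j-l+1)!}=\frac{(-1)^{n+1}\sqrt{\pi}}{8\cdot n!}.$$ *)

(* Defs.v *)
From mathcomp Require Import all_boot all_order all_algebra.
From mathcomp Require Import all_classical all_reals all_analysis.

Set Implicit Arguments.
Unset Strict Implicit.
Unset Printing Implicit Defensive.

Import Order.TTheory GRing.Theory Num.Theory.

Local Open Scope classical_set_scope.
Local Open Scope ring_scope.

(* Euler's integral of the second kind, meaningful for 0 < s. For s <= 0 the
   integral diverges and Rintegral returns the junk value 0. *)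
Definition Gamma (R : realType) (s : R) : R :=
  \int[lebesgue_measure]_(t in `]0, +oo[) (t `^ (s - 1) * expR (- t)).

(* Main.v *)
(* Put N = j + 1. Up to the factor (-1)^N / 2, the inner sum is the central
   divided difference of order 2N at 0 of x^2 (x^2 - 1)^(j + n). Since
   sum_i (-1)^i C(2N, i) (N - i)^(2r) / (2r)! is the coefficient of t^(2r) in
   (2 sinh (t / 2))^(2N), expanding (x^2 - 1)^(j + n) by the binomial theorem
   shows that the inner sum divided by (j + n)! is
     (-1)^N / (2 j!) * ((-1)^n / n! + (2j + 3) Q(j))
   with Q a polynomial of degree less than 2n: the coefficients of
   (2 sinh (t / 2) / t)^(2N) are polynomials in N divisible by N, and they come
   with the factors (N + 1/2) ... (N + k - 1/2), the first of which is
   (2j + 3) / 2. As omega >= 2n, the alternating sum against the binomials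
   C(omega, j) kills Q; what remains is
     sum_j (-1)^j C(omega, j) / (j + 3/2) = omega! / ((3/2) ... (omega + 3/2)),
   and the denominator cancels against Gamma(omega + 5/2), which t = x^2 and
   integration by parts reduce to the Gaussian integral. *)
Require Import Defs.
From mathcomp Require Import all_boot all_order all_algebra.
From mathcomp Require Import all_classical all_reals all_analysis measurable_realfun.
From mathcomp Require Import ring zify.

Import Order.TTheory GRing.Theory Num.Theory.
Import numFieldNormedType.Exports.

Local Open Scope classical_set_scope.
Local Open Scope ring_scope.

(** * Gamma at half-integers *)

Section gauss_moments.
Context {R : realType}.
Implicit Types (k n : nat) (b x : R).
Local Notation mu := (@lebesgue_measure R).

Definition gauss_moment k b : R :=
  \int[mu]_(x in `[0, b]) (x ^+ (2 * k) * gauss_fun x).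

Lemma is_derive_gauss_fun x :
  is_derive x 1 (@gauss_fun R) (- (2 * x) * gauss_fun x).
Proof.
rewrite /gauss_fun; apply: is_derive_eq.
by rewrite /GRing.scale/=; ring.
Qed.

Lemma derivable_continuous_LR (F : R -> R) a b :
  (forall x, derivable F x 1) -> derivable_oo_LRcontinuous F a b.
Proof.
move=> dF; have cF : continuous F.
  by move=> x; apply/differentiable_continuous/derivable1_diffP/dF.
split; first by move=> x _; exact: dF.
- by apply: cvg_at_right_filter; exact: cF.
- by apply: cvg_at_left_filter; exact: cF.
Qed.

(** Integration by parts of [x ^+ (2 * k).+1] against the derivative [- (2 * x) * gauss_fun x]; the
    boundary term at 0 vanishes. *)
Lemma gauss_momentS k b : 0 < b ->
  gauss_moment k.+1 b = (k%:R + 2^-1) * gauss_moment k b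
    - b ^+ (2 * k).+1 * gauss_fun b / 2.
Proof.
move=> b0.
have cM j : {within `[0, b], continuous (fun x : R => x ^+ j * gauss_fun x)}.
  apply: continuous_subspaceT => x.
  by apply: cvgM; [exact: exprn_continuous|exact: continuous_gauss_fun].
have iM j : mu.-integrable `[0, b]
    (EFin \o (fun x : R => x ^+ j * gauss_fun x)).
  by apply: continuous_compact_integrable => //; exact: segment_compact.
have := @Rintegration_by_parts R (fun x => x ^+ (2 * k).+1) gauss_fun
  (fun x => (2 * k).+1%:R * x ^+ (2 * k)) (fun x => - (2 * x) * gauss_fun x) 0 b b0.
have -> : \int[mu]_(x in `[0, b]) (x ^+ (2 * k).+1 * (- (2 * x) * gauss_fun x))
    = - 2 * gauss_moment k.+1 b.
  rewrite /gauss_moment -RintegralZl//.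
  by apply: eq_Rintegral => x _; rewrite mulnS exprD exprS; ring.
have -> : \int[mu]_(x in `[0, b]) ((2 * k).+1%:R * x ^+ (2 * k) * gauss_fun x)
    = (2 * k).+1%:R * gauss_moment k b.
  rewrite /gauss_moment -RintegralZl//.
  by apply: eq_Rintegral => x _; rewrite mulrA.
move=> H.
have {H} : - 2 * gauss_moment k.+1 b = b ^+ (2 * k).+1 * gauss_fun b
    - 0 ^+ (2 * k).+1 * gauss_fun 0 - (2 * k).+1%:R * gauss_moment k b.
  apply: H.
  - apply: continuous_subspaceT => x.
    by apply: cvgM; [exact: cvg_cst|exact: exprn_continuous].
  - by apply: derivable_continuous_LR => x; exact: exprn_derivable.
  - by move=> x _; rewrite derive1E exp_derive/= /GRing.scale/= mulr1.
  - apply: continuous_subspaceT => x; apply: cvgM; last exact: continuous_gauss_fun.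
    by apply: cvgN; apply: cvgM; [exact: cvg_cst|exact: cvg_id].
  - by apply: derivable_continuous_LR => x; have [] := is_derive_gauss_fun x.
  - by move=> x _; rewrite derive1E; have [_ ->] := is_derive_gauss_fun x.
rewrite -[(2 * k).+1%:R]natr1 natrM expr0n/= mul0r subr0 => H.
by apply: (@mulfI _ (-2)); [rewrite oppr_eq0 pnatr_eq0|rewrite H; field].
Qed.

(** Since [expR y] dominates y^(k+1) / (k+1)!, taking y = (n+1)^2 bounds the term by (k+1)! /
    (n+1). *)
Lemma gauss_momentS_boundary_cvg k :
  (n.+1%:R : R) ^+ (2 * k).+1 * gauss_fun (n.+1%:R : R) / 2 @[n --> \oo] --> (0 : R).
Proof.
apply: (@squeeze_cvgr _ _ _ _ (cst 0) (fun n => k.+1`!%:R * harmonic n)).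
- near=> n; rewrite mulr_ge0 ?mulr_ge0 ?exprn_ge0 ?expR_ge0 ?invr_ge0//=.
  have n0 : 0 < (n.+1%:R : R) by rewrite ltr0n.
  have := @expR_ge1Dxn R (n.+1%:R ^+ 2) k (exprn_ge0 _ (ltW n0)).
  rewrite /gauss_fun expRN => H.
  have {}H : n.+1%:R ^+ (2 * k).+1 * n.+1%:R <= k.+1`!%:R * expR (n.+1%:R ^+ 2) :> R.
    rewrite -ler_pdivrMl ?ltr0n ?fact_gt0// (le_trans _ H)//.
    by rewrite -exprSr -exprM mulnS mulrC ler_wpDl.
  rewrite /harmonic/= ler_pdivrMr// ler_pdivrMr ?expR_gt0//.
  rewrite -mulrA mulrAC mulrA ler_pdivlMr//.
  by rewrite (le_trans H)// ler_wpM2r ?expR_ge0// ler_peMr// ler1n.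
- exact: cvg_cst.
- rewrite -[X in _ --> X](mulr0 k.+1`!%:R).
  by apply: cvgM; [exact: cvg_cst|exact: cvg_harmonic].
Unshelve. all: end_near. Qed.

(** The recurrence passes to the limit; the base case is the Gaussian integral over the
    half-line. *)
Lemma gauss_moment_cvg k :
  gauss_moment k n.+1%:R @[n --> \oo] -->
    \prod_(i < k) (i%:R + 2^-1) * (Num.sqrt (pi : R) / 2).
Proof.
elim: k => [|k ih].
  rewrite big_ord0 mul1r.
  have gm0 n : (\int[mu]_(x in `[0%R, n%:R]) (gauss_fun x)%:E)%E
      = (gauss_moment 0 n%:R)%:E.
    rewrite /gauss_moment /Rintegral fineK; last first.
      apply: integrable_fin_num => //; apply: continuous_compact_integrable.
        exact: segment_compact.
      apply: continuous_subspaceT => x.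
      by apply: cvgM; [exact: cvg_cst|exact: continuous_gauss_fun].
    by apply: eq_integral => x _; rewrite mul1r.
  have := @ge0_cvgn_integral R mu _ gauss_fun_ge0
    measurable_gauss_fun.
  rewrite integral0y_gauss; under eq_fun do rewrite gm0.
  by rewrite -cvg_shiftS => /fine_cvg.
under eq_fun do rewrite gauss_momentS ?ltr0n//.
rewrite big_ord_recr/= mulrAC mulrC -[_ * (_ * _)]subr0.
apply: cvgB; last exact: gauss_momentS_boundary_cvg.
by apply: cvgM; [exact: cvg_cst|exact: ih].
Qed.

End gauss_moments.

(** The square root replaces a power with real exponent: it is continuous on the whole line and 0 at
    negative arguments, so the integrand is continuous and nonnegative everywhere. *)
Definition half_gamma_integrand {R : realType} k (t : R) : R :=
  t ^+ k * Num.sqrt t * expR (- t).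

Section Gamma_half_integer.
Context {R : realType}.
Implicit Types (k n : nat) (b t x : R).
Local Notation mu := (@lebesgue_measure R).
Local Notation half_gamma_integrand := (@half_gamma_integrand R).

Lemma half_gamma_integrand_ge0 k t : 0 <= half_gamma_integrand k t.
Proof.
rewrite /half_gamma_integrand; have [t0|/ltW t0] := leP 0 t.
  by rewrite !mulr_ge0 ?exprn_ge0 ?sqrtr_ge0 ?expR_ge0.
by rewrite ler0_sqrtr// mulr0 mul0r.
Qed.

Lemma continuous_half_gamma_integrand k : continuous (half_gamma_integrand k).
Proof.
move=> x; apply: cvgM; first apply: cvgM.
- exact: exprn_continuous.
- exact: sqrt_continuous.
- by apply: continuous_comp; [exact: continuousN|exact: continuous_expR].
Qed.

Lemma measurable_half_gamma_integrand k :
  measurable_fun setT (half_gamma_integrand k).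
Proof.
apply: open_continuous_measurable_fun; first exact: openT.
by move=> t _; exact: continuous_half_gamma_integrand.
Qed.

(** Substitution t = x^2, under which t^k sqrt(t) dt becomes 2 x^(2k+2) dx. *)
Lemma integral_half_gamma_integrand k b : 0 < b ->
  (\int[mu]_(t in `[0%R, (b ^+ 2)%R]) (half_gamma_integrand k t)%:E)%E
  = (2 * gauss_moment k.+1 b)%:E.
Proof.
move=> b0.
have dX (x : R) : derive1 (fun y : R => y ^+ 2) x = 2 * x.
  by rewrite exp_derive1 /GRing.scale/= expr1.
have c2 : continuous (fun x : R => 2 * x).
  by move=> x; apply: cvgM; [exact: cvg_cst|exact: cvg_id].
have dX' : derive1 (fun y : R => y ^+ 2) = (fun x => 2 * x) by apply/funext => x.
have := @integration_by_substitution_increasing R (fun y : R => y ^+ 2)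
  (half_gamma_integrand k) 0 b (ltW b0).
rewrite expr0n/= => ->; last 6 first.
- move=> x y; rewrite !in_itv/= => /andP[x0 _] /andP[y0 _] xy.
  by rewrite ltr_pXn2r// nnegrE.
- by move=> x _; rewrite dX'; exact: c2.
- by rewrite dX'; apply/cvg_ex; exists (2 * 0); apply: cvg_at_right_filter; exact: c2.
- by rewrite dX'; apply/cvg_ex; exists (2 * b); apply: cvg_at_left_filter; exact: c2.
- by apply: derivable_continuous_LR => x; exact: exprn_derivable.
- by apply: continuous_subspaceT; exact: continuous_half_gamma_integrand.
have cM : {within `[0, b], continuous (fun x : R => x ^+ (2 * k.+1) * gauss_fun x)}.
  apply: continuous_subspaceT => x.
  by apply: cvgM; [exact: exprn_continuous|exact: continuous_gauss_fun].
have iM : mu.-integrable `[0, b] (EFin \o (fun x : R => x ^+ (2 * k.+1) * gauss_fun x)).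
  by apply: continuous_compact_integrable => //; exact: segment_compact.
rewrite EFinM /gauss_moment /Rintegral fineK; last exact: integrable_fin_num.
rewrite -integralZl//; apply: eq_integral => x.
rewrite inE/= in_itv/= => /andP[x0 _].
rewrite -EFinM; congr EFin.
rewrite !fctE /half_gamma_integrand dX /gauss_fun sqrtr_sqr ger0_norm//.
by rewrite mulnS exprD -exprM expr2; ring.
Qed.

Lemma Gamma_half_integer k :
  Gamma (k%:R + 3 / 2 : R) = \prod_(i < k.+1) (i%:R + 2^-1) * Num.sqrt pi.
Proof.
have powRE t : 0 < t ->
    t `^ (k%:R + 3 / 2 - 1) * expR (- t) = half_gamma_integrand k t.
  move=> t0; rewrite /half_gamma_integrand.
  have -> : k%:R + 3 / 2 - 1 = k%:R + 2^-1 :> R by field.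
  rewrite powRD; last by rewrite (gt_eqF t0) implybT.
  by rewrite powR_mulrn ?ltW// powR12_sqrt// ltW.
have -> : Gamma (k%:R + 3 / 2 : R)
    = fine (\int[mu]_(t in `[0%R, +oo[) (half_gamma_integrand k t)%:E)%E.
  rewrite /Gamma /Rintegral; congr fine.
  rewrite -integral_itv_obnd_cbnd; last first.
    apply/measurable_EFinP; apply: measurable_funTS.
    exact: measurable_half_gamma_integrand.
  apply: eq_integral => t; rewrite inE/= in_itv/= andbT => t0.
  by rewrite powRE.
(* The substitution ends at (n+1)^2, so the convergence over the intervals [0, n] is taken along the
   subsequence of squares. *)
have sq_infty : (fun n => n.+1 ^ 2)%N @ \oo --> \oo.
  apply/cvgnyPge => A; near=> n.
  have : (A <= n)%N by near: n; exact: nbhs_infty_ge.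
  by move=> /leq_trans; apply; rewrite (leq_trans (leqnSn n))// -[leqLHS]expn1 leq_pexp2l.
have cI : (\int[mu]_(t in `[0%R, (n.+1%:R ^+ 2)%R]) (half_gamma_integrand k t)%:E)%E
    @[n --> \oo] --> (\int[mu]_(t in `[0%R, +oo[) (half_gamma_integrand k t)%:E)%E.
  under eq_fun do rewrite -natrX.
  exact: (cvg_comp _ _ sq_infty (@ge0_cvgn_integral R mu _
    (half_gamma_integrand_ge0 k) (measurable_half_gamma_integrand k))).
move: cI; under eq_fun do rewrite integral_half_gamma_integrand ?ltr0n//.
move=> cI.
have cM : (2 * gauss_moment k.+1 n.+1%:R)%:E @[n --> \oo] -->
    (\prod_(i < k.+1) (i%:R + 2^-1) * Num.sqrt (pi : R))%:E.
  apply: cvg_EFin; first exact: nearW.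
  have -> : \prod_(i < k.+1) (i%:R + 2^-1) * Num.sqrt (pi : R) =
      2 * (\prod_(i < k.+1) (i%:R + 2^-1) * (Num.sqrt (pi : R) / 2)).
    by field.
  by apply: cvgM; [exact: cvg_cst|exact: gauss_moment_cvg].
by rewrite (cvg_unique _ cI cM).
Unshelve. all: end_near. Qed.

End Gamma_half_integer.

(** * Alternating binomial sums and powers of the hyperbolic sine *)

Section alternating_binomial_sums.
Context {F : numFieldType}.
Implicit Types (a b x : F) (i j k m n M : nat) (p q : {poly F}).

(** Polynomials stand in for power series in t, here exp(a t); identities are asserted only for
    coefficients of index below [M]. *)
Definition trunc_exp M a : {poly F} := \poly_(i < M) (a ^+ i / i`!%:R).

(* [sinhc M] truncates [s |-> 2 sinh (sqrt s / 2) / sqrt s]. *)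
Definition sinhc M : {poly F} := \poly_(i < M) (4 ^+ i * (2 * i).+1`!%:R)^-1.

Lemma coefM_trunc M p p' q q' :
  (forall i, (i < M)%N -> p`_i = p'`_i) ->
  (forall i, (i < M)%N -> q`_i = q'`_i) ->
  forall i, (i < M)%N -> (p * q)`_i = (p' * q')`_i.
Proof.
move=> pp' qq' i iM; rewrite !coefM; apply: eq_bigr => -[j /= ji] _.
by rewrite pp' ?(leq_trans ji)// qq'// (leq_ltn_trans (leq_subr _ _)).
Qed.

Lemma coefX_trunc M p q n :
  (forall i, (i < M)%N -> p`_i = q`_i) ->
  forall i, (i < M)%N -> (p ^+ n)`_i = (q ^+ n)`_i.
Proof.
move=> pq; elim: n => [|n ih] i iM; first by rewrite !expr0.
by rewrite !exprS; exact: (@coefM_trunc M).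
Qed.

Lemma fact_neq0 n : n`!%:R != 0 :> F.
Proof. by rewrite pnatr_eq0 -lt0n fact_gt0. Qed.

Lemma natr_bin n m : (m <= n)%N ->
  'C(n, m)%:R = n`!%:R / (m`!%:R * (n - m)`!%:R) :> F.
Proof.
move=> mn; rewrite -(bin_fact mn) !natrM mulfK// mulf_neq0 ?fact_neq0//.
Qed.

Lemma trunc_expD M a b i : (i < M)%N ->
  (trunc_exp M a * trunc_exp M b)`_i = (trunc_exp M (a + b))`_i.
Proof.
move=> iM; rewrite coefM coef_poly iM addrC exprDn mulr_suml.
apply: eq_bigr => -[j /= ji] _.
rewrite !coef_poly (leq_trans ji)// (leq_ltn_trans (leq_subr _ _))//.
rewrite -[_ *+ 'C(_, _)]mulr_natr natr_bin//.
by field; rewrite !fact_neq0.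
Qed.

Lemma trunc_expX M a n i : (i < M)%N ->
  (trunc_exp M a ^+ n)`_i = (trunc_exp M (n%:R * a))`_i.
Proof.
elim: n i => [|n ih] i iM.
  by rewrite expr0 mul0r coef_poly iM coef1 expr0n; case: i iM => [|i] iM;
    rewrite ?fact0 ?divr1 ?mul0r.
rewrite exprS (@coefM_trunc M _ (trunc_exp M a) _ (trunc_exp M (n%:R * a)))//.
by rewrite trunc_expD// -natr1 mulrDl mul1r addrC.
Qed.

(** Modulo t^M this is 2 sinh(t/2) = exp(t/2) - exp(-t/2); the even degrees cancel on the right. *)
Lemma coef_sinh M i : (i < M)%N ->
  ('X * (sinhc M \Po 'X^2))`_i = (trunc_exp M 2^-1 - trunc_exp M (- 2^-1))`_i.
Proof.
move=> iM; rewrite coefXM coefB !coef_poly iM.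
case: i iM => [|i] iM; first by rewrite !expr0 subrr.
rewrite /= coef_comp_poly_Xn// coef_poly exprNn -signr_odd/= dvdn2.
case: (boolP (odd i)) => i_odd /=; first by rewrite expr0 mul1r subrr.
have -> : (i %/ 2 < M)%N by apply: leq_ltn_trans (leq_div _ _) (ltnW iM).
have -> : i = (2 * (i %/ 2))%N by rewrite mulnC divnK// dvdn2.
rewrite mulKn// expr1; set j := (i %/ 2)%N.
have E : 2^-1 ^+ (2 * j) = (4 ^+ j)^-1 :> F.
  by rewrite exprM !exprVn; congr (_ ^+ _)^-1; ring.
by rewrite exprS E; field; rewrite fact_neq0 expf_neq0// pnatr_eq0.
Qed.

(** Compare coefficients of t^r in the binomial expansion of (exp(t/2) - exp(-t/2))^m, whose i-th
    term carries exp((m/2 - i) t). *)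
Lemma alternating_central_powers M m r : (r < M)%N ->
  \sum_(i < m.+1) (-1) ^+ i * 'C(m, i)%:R * (m%:R / 2 - i%:R) ^+ r
  = r`!%:R * (('X * (sinhc M \Po 'X^2)) ^+ m)`_r.
Proof.
move=> rM; rewrite (@coefX_trunc M _ _ _ (@coef_sinh M))//.
rewrite exprBn coef_sum mulr_sumr; apply: eq_bigr => -[i /= im] _.
rewrite coefMn.
have -> : ((-1) ^+ i * trunc_exp M 2^-1 ^+ (m - i) * trunc_exp M (- 2^-1) ^+ i)`_r
    = (-1) ^+ i * ((m%:R / 2 - i%:R) ^+ r / r`!%:R).
  rewrite -mulrA -!(signr_odd _ i) !mulr_sign.
  have -> : (m%:R / 2 - i%:R) ^+ r / r`!%:R =
      (trunc_exp M 2^-1 ^+ (m - i) * trunc_exp M (- 2^-1) ^+ i)`_r.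
    rewrite (@coefM_trunc M _ _ _ _ (trunc_expX _ _ _) (trunc_expX _ _ _))//.
    rewrite trunc_expD// coef_poly rM natrB//.
    by congr (_ ^+ _ / _); field.
  by case: odd; rewrite ?coefN.
by rewrite -[_ *+ 'C(_, _)]mulr_natr; field; rewrite fact_neq0.
Qed.

(** An m-th finite difference kills degrees below m: after recentring at m/2, each power r < m reads
    off a coefficient of (2 sinh(t/2))^m, which is divisible by t^m. *)
Lemma alternating_binomial_poly m p : (size p <= m)%N ->
  \sum_(i < m.+1) (-1) ^+ i * 'C(m, i)%:R * p.[i%:R] = 0.
Proof.
move=> pm; pose q := p \Po ((m%:R / 2)%:P - 'X).
have pE i : p.[i%:R] = \sum_(r < size q) q`_r * (m%:R / 2 - i%:R) ^+ r.
  rewrite -horner_coef /q horner_comp !hornerE; congr p.[_]; ring.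
under eq_bigr do rewrite pE mulr_sumr.
rewrite exchange_big/= big1// => -[r /= rq] _.
under eq_bigr do rewrite mulrCA.
rewrite -mulr_sumr (@alternating_central_powers r.+1)//.
have rm : (r < m)%N.
  rewrite (leq_trans rq)// (leq_trans _ pm)// size_comp_poly2//.
  by rewrite -opprB size_polyN size_XsubC.
by rewrite exprMn coefXnM rm !mulr0.
Qed.

(** Pascal's rule gives S(m+1, x) = S(m, x) - S(m, x+1) for the left-hand side S, and the right-hand
    side obeys the same recurrence. *)
Lemma alternating_binomial_inv m x : 0 < x ->
  \sum_(i < m.+1) (-1) ^+ i * 'C(m, i)%:R / (x + i%:R)
  = m`!%:R / \prod_(i < m.+1) (x + i%:R).
Proof.
have nz n (y : F) : 0 < y -> y + n%:R != 0.
  by move=> y0; rewrite gt_eqF// ltr_wpDr.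
elim: m x => [|m ih] x x0.
  by rewrite !big_ord1 expr0 bin0 fact0 mul1r.
rewrite [LHS]big_ord_recl/= expr0 mul1r.
under eq_bigr => i _.
  rewrite /bump/= add1n binS natrD mulrDr mulrDl exprS mulN1r !mulNr.
  over.
rewrite big_split/= !sumrN.
have H1 : x^-1 - \sum_(i < m.+1) (-1) ^+ i * 'C(m, i.+1)%:R / (x + i.+1%:R)
    = \sum_(i < m.+1) (-1) ^+ i * 'C(m, i)%:R / (x + i%:R).
  rewrite big_ord_recr/= bin_small// mulr0 mul0r addr0 [RHS]big_ord_recl/=.
  rewrite bin0 expr0 !mul1r addr0 -sumrN; congr (_ + _).
  by apply: eq_bigr => i _; rewrite /bump/= add1n exprS mulN1r !mulNr.
have H2 : \sum_(i < m.+1) (-1) ^+ i * 'C(m, i)%:R / (x + i.+1%:R)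
    = m`!%:R / \prod_(i < m.+1) (x + 1 + i%:R).
  by rewrite -ih ?ltr_wpDr//; apply: eq_bigr => i _; rewrite -natr1 addrA addrAC.
rewrite bin0 mul1r addr0 addrA {}H1 {}H2 ih//.
have P1 n : \prod_(i < n.+1) (x + i%:R) = x * \prod_(i < n) (x + 1 + i%:R).
  rewrite big_ord_recl/= addr0; congr (_ * _).
  by apply: eq_bigr => i _; rewrite /bump/= add1n -natr1 addrA addrAC.
rewrite !P1 big_ord_recr/= factS natrM -natr1.
have P0 : \prod_(i < m) (x + 1 + i%:R) != 0.
  by apply/prodf_neq0 => i _; rewrite nz// ltr_wpDr.
by field; rewrite P0 (gt_eqF x0) nz// ltr_wpDr.
Qed.


(** * Polynomial dependence of the coefficients on the exponent *)

(** The binomial coefficient C(2X + 1, i) as a polynomial in X. *)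
Definition bin_poly i : {poly F} :=
  (i`!%:R)^-1 *: \prod_(t < i) (2%:P * 'X + (1 - t%:R)%:P).

Lemma natr_ffact n m : (n ^_ m)%:R = \prod_(t < m) (n%:R - t%:R) :> F.
Proof.
elim: m => [|m ih]; first by rewrite big_ord0 ffactn0.
rewrite big_ord_recr/= -ih ffactnSr natrM.
have [mn|nm] := leqP m n; first by rewrite natrB.
by rewrite ffact_small// !mul0r.
Qed.

Lemma horner_bin_poly i j : (bin_poly i).[j%:R] = 'C(2 * j + 1, i)%:R.
Proof.
rewrite hornerZ horner_prod; apply: (mulfI (fact_neq0 i)).
rewrite mulrA mulfV ?fact_neq0// mul1r [RHS]mulrC -natrM bin_ffact natr_ffact.
by apply: eq_bigr => t _; rewrite !hornerE/= natrD natrM; ring.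
Qed.

Lemma size_prod_linear (I : finType) (f : I -> {poly F}) :
  (forall t, (size (f t) <= 2)%N) -> (size (\prod_t f t)%R <= #|I|.+1)%N.
Proof.
move=> f2; apply: (leq_trans (size_poly_prod_leq _ _)).
have -> : #|xpredT : pred I| = #|I| by exact: eq_card.
have : (\sum_t size (f t) <= #|I| * 2)%N by rewrite -sum_nat_const; exact: leq_sum.
by lia.
Qed.

Lemma size_linear (a b : F) : (size (a%:P * 'X + b%:P)%R <= 2)%N.
Proof.
rewrite (leq_trans (size_polyD _ _))// geq_max.
by rewrite (leq_trans (size_polyC_leq1 _))// mul_polyC (leq_trans (size_scale_leq _ _))// size_polyX.
Qed.

Lemma size_bin_poly i : (size (bin_poly i) <= i.+1)%N.
Proof.
rewrite (leq_trans (size_scale_leq _ _))//.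
have := @size_prod_linear 'I_i (fun t => 2%:P * 'X + (1 - t%:R)%:P).
by rewrite card_ord; apply => t; exact: size_linear.
Qed.

Lemma sinhc_coef0 M n : (sinhc M.+1 ^+ n)`_0 = 1.
Proof.
by elim: n => [|n ih]; rewrite ?expr0 ?coef1// exprS coef0M ih mulr1 coef_poly/= expr0 mul1r (_ : _`! = 1%N)// invr1.
Qed.

(* The binomial series of [(1 + (sinhc - 1)) ^+ m] stops at the [k]-th power
   in degree [k], so the coefficient is a polynomial in the exponent [m],
   divisible by [m]. *)
Lemma sinhc_coef_poly M k : (k < M)%N ->
  exists2 q : {poly F}, (size q <= k.+1)%N &
    forall j, (sinhc M.+1 ^+ (2 * j.+1))`_k.+1 = j.+1%:R * q.[j%:R].
Proof.
move=> kM; pose u : {poly F} := sinhc M.+1 - 1.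
have uE : u = 'X * \poly_(i < M) u`_i.+1.
  apply/polyP => -[|i]; rewrite coefXM/=.
    by rewrite coefB coef_poly/= coef1 expr0 mul1r (_ : _`! = 1%N)// invr1 subrr.
  rewrite [RHS]coef_poly; case: ifPn => // iM.
  by rewrite coefB coef_poly coef1 ltnS (negbTE iM) subrr.
have u_small i l : (l < i)%N -> (u ^+ i)`_l = 0.
  by move=> li; rewrite uE exprMn coefXnM li.
exists (\sum_(i < k.+1) (2 / i.+1%:R * (u ^+ i.+1)`_k.+1) *: bin_poly i).
  apply: (leq_trans (size_sum _ _ _)); apply/bigmax_leqP => i _.
  by rewrite (leq_trans (size_scale_leq _ _))// (leq_trans (size_bin_poly i)).
move=> j; have -> : sinhc M.+1 = 1 + u by rewrite addrC subrK.
rewrite exprDn.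
under eq_bigr do rewrite expr1n mul1r.
rewrite coef_sum -(big_mkord xpredT (fun i => (u ^+ i *+ 'C(2 * j.+1, i))`_k.+1)).
(* Either of [2 * j.+1] and [k.+1] may be the smaller: the sum is first extended by vanishing
   binomials, then cut where the powers of [u] have no coefficient of index [k.+1]. *)
have extend n : (2 * j.+1 < n)%N -> \sum_(0 <= i < (2 * j.+1).+1)
    (u ^+ i *+ 'C(2 * j.+1, i))`_k.+1
    = \sum_(0 <= i < n) (u ^+ i *+ 'C(2 * j.+1, i))`_k.+1.
  move=> jn; rewrite [RHS](big_cat_nat (n := (2 * j.+1).+1))//=.
  rewrite [X in _ = _ + X]big1_seq ?addr0// => i /=; rewrite mem_index_iota => /andP[ji _].
  by rewrite bin_small// mulr0n coef0.
rewrite (extend (k.+2 + (2 * j.+1).+1)%N) ?leq_addl//.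
rewrite (big_cat_nat (n := k.+2))//= ?leq_addr//.
rewrite [X in _ + X]big1_seq ?addr0; last first.
  by move=> i /=; rewrite mem_index_iota => /andP[ki _]; rewrite coefMn u_small// mul0rn.
rewrite big_nat_recl// expr0 mulr1n coef1 add0r big_mkord.
rewrite horner_sum mulr_sumr; apply: eq_bigr => i _.
rewrite hornerZ horner_bin_poly coefMn -[_ *+ 'C(_, _)]mulr_natr.
(* Absorption in the binomial coefficient supplies the factor [j.+1]. *)
have -> : 'C(2 * j.+1, i.+1)%:R = 2 * j.+1%:R / i.+1%:R * 'C(2 * j + 1, i)%:R :> F.
  apply: (@mulfI _ i.+1%:R); first by rewrite pnatr_eq0.
  rewrite -[LHS]natrM -mul_bin_diag !natrM mulnS add2n/= addn1.
  by field; rewrite nat1r pnatr_eq0.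
by field; rewrite nat1r pnatr_eq0.
Qed.

(** * The inner sum *)

Definition inner_sum j n : F :=
  \sum_(0 <= l < j.+2)
    (-1) ^+ l * l%:R ^+ 2 * (l%:R ^+ 2 - 1) ^+ (j + n)
      / ((j + l + 1)`!%:R * (j + 1 - l)`!%:R).

(** (2 sinh(t/2))^(2N) is t^(2N) times a series in t^2, so the power 2s reads off index s - N of
    that series. *)
Lemma alternating_even_powers M N s : (2 * s < M)%N ->
  \sum_(i < (2 * N).+1) (-1) ^+ i * 'C(2 * N, i)%:R * (N%:R - i%:R) ^+ (2 * s)
  = (2 * s)`!%:R * (if (s < N)%N then 0 else (sinhc M ^+ (2 * N))`_(s - N)).
Proof.
move=> sM; have := @alternating_central_powers M (2 * N) (2 * s) sM.
have -> : (2 * N)%:R / 2 = N%:R :> F by rewrite natrM; field.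
move=> ->; rewrite exprMn coefXnM ltn_mul2l/=; congr (_ * _).
case: ltnP => // Ns; rewrite -rmorphXn/= coef_comp_poly_Xn// -mulnBr dvdn_mulr//.
by rewrite mulKn.
Qed.

(* Folds the sum over [-N <= N - i <= N] onto its nonnegative half; the middle
   term vanishes with [l ^+ 2]. *)
Lemma inner_sum_central j n : let N := j.+1 in
  \sum_(i < (2 * N).+1) (-1) ^+ i * 'C(2 * N, i)%:R *
    ((N%:R - i%:R) ^+ 2 * ((N%:R - i%:R) ^+ 2 - 1) ^+ (j + n))
  = 2 * (2 * N)`!%:R * (-1) ^+ N * inner_sum j n.
Proof.
move=> N; pose g i : F := (-1) ^+ i * 'C(2 * N, i)%:R *
    ((N%:R - i%:R) ^+ 2 * ((N%:R - i%:R) ^+ 2 - 1) ^+ (j + n)).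
have gE l : (l <= N)%N -> g (N + l)%N = (2 * N)`!%:R * (-1) ^+ N *
   ((-1) ^+ l * l%:R ^+ 2 * (l%:R ^+ 2 - 1) ^+ (j + n)
      / ((j + l + 1)`!%:R * (j + 1 - l)`!%:R)).
  move=> lN; rewrite /g natr_bin; last by lia.
  have -> : (2 * N - (N + l) = j + 1 - l)%N by rewrite /N; lia.
  have -> : (N + l = j + l + 1)%N by rewrite /N; lia.
  have -> : (N%:R - (j + l + 1)%:R) ^+ 2 = l%:R ^+ 2 :> F.
    by rewrite /N -natr1 !natrD; ring.
  have -> : (-1) ^+ (j + l + 1) = (-1) ^+ N * (-1) ^+ l :> F.
    by rewrite /N -exprD; congr (_ ^+ _); lia.
  by field; rewrite !fact_neq0.
have gN l : (l <= N)%N -> g (N - l)%N = g (N + l)%N.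
  move=> lN; rewrite /g.
  have -> : 'C(2 * N, N - l) = 'C(2 * N, N + l).
    by rewrite -bin_sub; [congr 'C(_, _)|]; lia.
  have -> : (-1) ^+ (N - l) = (-1) ^+ (N + l) :> F.
    rewrite -signr_odd -[RHS]signr_odd oddB// oddD//.
  have -> : (N%:R - (N - l)%:R) ^+ 2 = (N%:R - (N + l)%:R) ^+ 2 :> F.
    by rewrite natrB// natrD; ring.
  by [].
have g0 : g N = 0 by rewrite /g subrr expr0n/= mul0r mulr0.
have half : \sum_(0 <= l < N.+1) g (N + l)%N = (2 * N)`!%:R * (-1) ^+ N * inner_sum j n.
  rewrite /inner_sum mulr_sumr big_nat [RHS]big_nat; apply: eq_bigr => l /andP[_ lN].
  exact: gE.
rewrite -(big_mkord xpredT g).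
rewrite (big_cat_nat (n := N.+1))//=; last by rewrite /N; lia.
have -> : \sum_(0 <= i < N.+1) g i = \sum_(0 <= l < N.+1) g (N + l)%N.
  rewrite big_nat_rev/= big_nat [RHS]big_nat; apply: eq_bigr => l /andP[_ lN].
  by rewrite add0n subSS gN.
have -> : \sum_(N.+1 <= i < (2 * N).+1) g i = \sum_(0 <= l < N.+1) g (N + l)%N.
  rewrite [RHS]big_nat_recl//= addn0 g0 add0r.
  rewrite -{1}[N.+1]add0n big_addn.
  have -> : ((2 * N).+1 - N.+1 = N)%N by lia.
  by apply: eq_bigr => i _; congr g; lia.
by rewrite half; ring.
Qed.

(** With N = j + 1, expanding (x^2 - 1)^(j+n) leaves only the powers x^(2(N+k)), 0 <= k <= n: the
    difference of order 2N kills the lower ones. *)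
Lemma inner_sumE M j n : (2 * (j.+1 + n) < M)%N ->
  inner_sum j n = (-1) ^+ j.+1 / (2 * (2 * j.+1)`!%:R) *
    \sum_(k < n.+1) (-1) ^+ (n - k) * 'C(j + n, n - k)%:R *
      ((2 * (j.+1 + k))`!%:R * (sinhc M ^+ (2 * j.+1))`_k).
Proof.
move=> HM; set N := j.+1.
have -> : inner_sum j n = (-1) ^+ N / (2 * (2 * N)`!%:R) *
    (2 * (2 * N)`!%:R * (-1) ^+ N * inner_sum j n).
  have s2 : (-1) ^+ N * (-1) ^+ N = 1 :> F by rewrite -exprMn mulrNN mulr1 expr1n.
  rewrite -[LHS]mul1r -[in LHS]s2.
  by field; rewrite fact_neq0.
rewrite -inner_sum_central; congr (_ * _).
have pw y : y * (y - 1) ^+ (j + n) =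
    \sum_(0 <= i < (j + n).+1) (-1) ^+ i * 'C(j + n, i)%:R * y ^+ (j + n - i).+1 :> F.
  rewrite exprBn mulr_sumr big_mkord; apply: eq_bigr => i _.
  by rewrite expr1n mulr1 -mulr_natr exprS; ring.
under eq_bigr do rewrite pw mulr_sumr.
rewrite exchange_big/=.
rewrite (big_cat_nat (n := n.+1))//=; last by lia.
rewrite [X in _ + X]big1_seq ?addr0; last first.
  move=> i /=; rewrite mem_index_iota => /andP[ni inj].
  under eq_bigr do rewrite mulrCA -exprM.
  rewrite -mulr_sumr (@alternating_even_powers M)/=; last by lia.
  have -> : ((j + n - i).+1 < N)%N by rewrite /N; lia.
  by rewrite !mulr0.
(* Reversing the order introduces k = n - i, the excess of half the exponent over [N]. *)
rewrite big_nat_rev big_mkord/=; apply: eq_bigr => -[k /= kn] _.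
rewrite add0n subSS.
under eq_bigr do rewrite mulrCA -exprM.
rewrite -mulr_sumr (@alternating_even_powers M)/=; last by lia.
have -> : ((j + n - (n - k)).+1 = N + k)%N by rewrite /N; lia.
by rewrite ltnNge leq_addr/= addKn.
Qed.

(** With N = j + 1, the factors of (2N+2k)! / (2N)! pair up as 4 (N + t + 1/2) (N + t + 1). The
    integer ones multiply to (N+k)! / N!, of which (j+k)! leaves (N+k) / N!. *)
Lemma fact_double_ratio j k :
  (2 * (j.+1 + k))`!%:R / ((2 * j.+1)`!%:R * (j + k)`!%:R)
  = 4 ^+ k * \prod_(t < k) (j%:R + 3 / 2 + t%:R) * (j.+1 + k)%:R / j.+1`!%:R :> F.
Proof.
have fS m : m.+1`!%:R = m.+1%:R * m`!%:R :> F by rewrite factS natrM.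
elim: k => [|k ih].
  rewrite big_ord0 !addn0 expr0 (fS j).
  by field; rewrite !fact_neq0 nat1r pnatr_eq0.
have -> : (2 * (j.+1 + k.+1) = (2 * (j.+1 + k)).+2)%N by lia.
rewrite !addnS big_ord_recr/= exprSr.
move: ih; have := erefl ((2 * (j.+1 + k))%N%:R : F); rewrite {2}natrM natrD -natr1.
move: (2 * j.+1)%N (2 * (j.+1 + k))%N => b c cE ih.
rewrite !(fS c.+1) !(fS c) !(fS (j + k)%N).
transitivity (c.+2%:R * c.+1%:R / (j + k).+1%:R *
   (c`!%:R / (b`!%:R * (j + k)`!%:R)) : F).
  by field; rewrite !fact_neq0 -natrD nat1r pnatr_eq0.
rewrite ih; move: (\prod_(t < k) _) j.+1`! (fact_neq0 j.+1) => P f f0.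
rewrite -!natr1 cE natrD.
by field; rewrite f0 -natrD natr1 pnatr_eq0.
Qed.

(** The factor t = 0 of the product in [fact_double_ratio] is (2j + 3) / 2, and the factor [j.+1] of
    the [sinhc] coefficient turns 1 / (j+1)! into 1 / j!. *)
Lemma inner_sum_term_poly M k : (k < M)%N ->
  exists2 Q : {poly F}, (size Q <= 2 * k.+1)%N & forall j,
    (2 * (j.+1 + k.+1))`!%:R / ((2 * j.+1)`!%:R * (j + k.+1)`!%:R)
      * (sinhc M.+1 ^+ (2 * j.+1))`_k.+1
    = (2 * j%:R + 3) * Q.[j%:R] / j`!%:R.
Proof.
move=> /sinhc_coef_poly[q sq qE].
(* [A] collects the remaining k half-integer factors and [B] evaluates to j + k + 2; with [q] the
   degrees add up to at most k + 1 + k. *)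
pose A : {poly F} := \prod_(t < k) (1%:P * 'X + (5 / 2 + t%:R)%:P).
pose B : {poly F} := 1%:P * 'X + k.+2%:R%:P.
exists ((4 ^+ k.+1 / 2) *: (A * B * q)) => [|j].
  rewrite (leq_trans (size_scale_leq _ _))//.
  have sA : (size A <= k.+1)%N.
    rewrite -[k in leqRHS](card_ord k); apply: size_prod_linear => t.
    exact: size_linear.
  have sB : (size B <= 2)%N by exact: size_linear.
  have := size_polyMleq (A * B) q; have := size_polyMleq A B.
  by move: (size _) (size _) (size _) (size _) (size _) sA sB sq => a b c d e; lia.
rewrite fact_double_ratio qE hornerZ !hornerM.
have -> : B.[j%:R] = (j.+1 + k.+1)%:R.
  by rewrite /B hornerD hornerM !hornerC hornerX mul1r addSnnS natrD.
have -> : \prod_(t < k.+1) (j%:R + 3 / 2 + t%:R) = (2 * j%:R + 3) / 2 * A.[j%:R].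
  rewrite big_ord_recl/= addr0 /A horner_prod; congr (_ * _); first by field.
  by apply: eq_bigr => t _; rewrite hornerD hornerM !hornerC hornerX /bump add1n -natr1; field.
rewrite factS natrM.
by field; rewrite fact_neq0 nat1r pnatr_eq0.
Qed.

(** The term k = 0 of [inner_sumE] gives (-1)^n / n!; every later one has the factor 2j + 3. *)
Lemma inner_sum_poly n : exists2 Q : {poly F}, (size Q <= 2 * n)%N &
  forall j, inner_sum j n / (j + n)`!%:R = (-1) ^+ j.+1 / (2 * j`!%:R) *
    ((-1) ^+ n / n`!%:R + (2 * j%:R + 3) * Q.[j%:R]).
Proof.
have [Q QP QE] := @fin_all_exists2 'I_n _ _ _
  (fun k : 'I_n => @inner_sum_term_poly n k (ltn_ord k)).
exists (\sum_(k < n) ((-1) ^+ (n - k.+1) / (n - k.+1)`!%:R) *: Q k) => [|j].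
  apply: (leq_trans (size_sum _ _ _)); apply/bigmax_leqP => k _.
  rewrite (leq_trans (size_scale_leq _ _))// (leq_trans (QP k))//.
  by rewrite leq_mul2l ltn_ord.
rewrite (@inner_sumE (2 * (j.+1 + n)).+1)//.
(* Only indices up to n occur, so the truncation is lowered to [n.+1], which does not depend on j;
   hence one [Q] serves all j. *)
under eq_bigr => k _.
  rewrite (@coefX_trunc n.+1 _ (sinhc n.+1)) ?ltn_ord//; last first.
    by move=> i ni; rewrite !coef_poly ni; case: ifPn => //; lia.
  over.
transitivity ((-1) ^+ j.+1 / 2 * \sum_(k < n.+1) ((-1) ^+ (n - k) / (n - k)`!%:R *
   ((2 * (j.+1 + k))`!%:R / ((2 * j.+1)`!%:R * (j + k)`!%:R)
      * (sinhc n.+1 ^+ (2 * j.+1))`_k)) : F).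
  rewrite !mulr_sumr mulr_suml; apply: eq_bigr => -[k /= kn] _.
  rewrite natr_bin; last by lia.
  have -> : (j + n - (n - k) = j + k)%N by lia.
  by field; rewrite !fact_neq0.
rewrite big_ord_recl/= subn0 sinhc_coef0 !addn0.
have -> : (2 * j.+1)`!%:R / ((2 * j.+1)`!%:R * j`!%:R) = j`!%:R^-1 :> F.
  by rewrite invfM mulVKf ?fact_neq0.
have -> : \sum_(i < n) ((-1) ^+ (n - bump 0 i) / (n - bump 0 i)`!%:R *
   ((2 * (j.+1 + bump 0 i))`!%:R / ((2 * j.+1)`!%:R * (j + bump 0 i)`!%:R)
      * (sinhc n.+1 ^+ (2 * j.+1))`_(bump 0 i))) =
   (2 * j%:R + 3) / j`!%:R *
     (\sum_(k < n) ((-1) ^+ (n - k.+1) / (n - k.+1)`!%:R) *: Q k).[j%:R].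
  rewrite horner_sum mulr_sumr; apply: eq_bigr => k _.
  by rewrite /bump add1n QE hornerZ; field; rewrite !fact_neq0.
by field; rewrite !fact_neq0.
Qed.

End alternating_binomial_sums.

(** * The outer sum and the final constant *)

Theorem theorem1p3 (R : realType) (n omega : nat)
    (hn : (1 <= n)%N) (homega : (2 * n <= omega)%N) :
  \sum_(0 <= j < omega.+1)
     Gamma (omega%:R + 5 / 2 : R)
       / ((omega - j)`!%:R * (j + n)`!%:R * (2 * j%:R + 3))
     * \sum_(0 <= l < j.+2)
         (-1) ^+ l * l%:R ^+ 2 * (l%:R ^+ 2 - 1) ^+ (j + n)
           / ((j + l + 1)`!%:R * (j + 1 - l)`!%:R)
  = (-1) ^+ n.+1 * Num.sqrt pi / (8 * n`!%:R).
Proof.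
have [Q sQ QE] := @inner_sum_poly R n.
have nz3 j : 2 * j%:R + 3 != 0 :> R by rewrite gt_eqF// ltr_wpDl// mulr_ge0.
rewrite big_mkord.
(* Here 1 / ((omega - j)! j!) = C(omega, j) / omega!, and dividing by 2j + 3 leaves half of 1 / (j +
   3/2) and the polynomial [Q]. *)
transitivity (Gamma (omega%:R + 5 / 2 : R) / omega`!%:R * (- 2^-1) *
  \sum_(j < omega.+1) ((-1) ^+ n / n`!%:R / 2 *
      ((-1) ^+ j * 'C(omega, j)%:R / (3 / 2 + j%:R)) +
    (-1) ^+ j * 'C(omega, j)%:R * Q.[j%:R])).
  rewrite mulr_sumr; apply: eq_bigr => -[j /= jo] _.
  transitivity (Gamma (omega%:R + 5 / 2 : R) / ((omega - j)`!%:R * (2 * j%:R + 3)) *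
      (inner_sum j n / (j + n)`!%:R)).
    by rewrite /inner_sum; field; rewrite !fact_neq0 nz3.
  rewrite QE natr_bin// exprS.
  by field; rewrite !fact_neq0 [3 + _]addrC [j%:R * 2]mulrC nz3.
(* The size of [Q] is at most 2n <= omega, so its alternating sum vanishes. *)
rewrite big_split/= -mulr_sumr alternating_binomial_poly ?(leq_trans sQ)// addr0.
rewrite alternating_binomial_inv ?divr_gt0//.
have -> : omega%:R + 5 / 2 = omega.+1%:R + 3 / 2 :> R by rewrite -natr1; field.
(* The product for Gamma has [omega.+2] factors: the first, 1/2, joins -1/2 and 1/2 to give -1/8,
   and the others cancel the denominator. *)
rewrite Gamma_half_integer big_ord_recl/= add0r.
have -> : \prod_(i < omega.+1) ((bump 0 i)%:R + 2^-1)
    = \prod_(i < omega.+1) (3 / 2 + i%:R) :> R.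
  by apply: eq_bigr => i _; rewrite /bump add1n -natr1; field.
have P0 : \prod_(i < omega.+1) (3 / 2 + i%:R) != 0 :> R.
  by apply/prodf_neq0 => i _; rewrite gt_eqF// ltr_wpDr// divr_gt0.
by rewrite exprS; field; rewrite !fact_neq0 P0.
Qed.
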